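(* Let $n,s,t\in\mathbb{Z}_{>0}$ and suppose there are constants $\alpha,\beta,\gamma\in(0,1)$ with $\alpha n\le t<s\le\beta n$ and $s-t\ge\gamma n$. Let $\varepsilon\in(0,s-t)$ and $\nu>0$. Let $\theta_{11},\theta_{12},\theta_{21},\theta_{22}>0$ satisfy: $\theta_{21}=\nu$; $\theta_{12}<\frac{6n}{6n^2+5s(n-t)}$; $s\theta_{i1}+(n-s)\theta_{i2}=1$ for $i=1,2$; $\frac{t-n}{n}<t\theta_{11}+(n-t)\theta_{21}-1<0$; and $\frac{st(s-t)}{4n^3}<t\theta_{12}+(n-t)\theta_{22}-1<\frac{s(n-t)}{n(n-s)}$. Let $A$ be the $n\times n$ block matrix whose top-left $t\times s$ block has all entries $\theta_{11}$, bottom-left $(n-t)\times s$ block all entries $\theta_{21}$, top-right $t\times(n-s)$ block all entries $\theta_{12}$, and bottom-right $(n-t)\times(n-s)$ block all entries $\theta_{22}$. Let $A^{(0)},A^{(1)},\dots$ be the SK iterates with input $(A,(\boldsymbol{1},\boldsymbol{1}))$ and let $K$ be the least $k$ with $\|\boldsymbol{r}(A^{(k)})-\boldsymbol{1}\|_1+\|\boldsymbol{c}(A^{(k)})-\boldsymbol{1}\|_1\le\varepsilon$. Then $K=\Omega(-\log\nu-\log\varepsilon)$.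
   Context: SK with input $(A,(\boldsymbol{1},\boldsymbol{1}))$: $A^{(0)}_{ij}=A_{ij}/r_i(A)$; odd $k$: $A^{(k)}_{ij}=A^{(k-1)}_{ij}/c_j(A^{(k-1)})$; even $k\ge2$: $A^{(k)}_{ij}=A^{(k-1)}_{ij}/r_i(A^{(k-1)})$, with $r_i,c_j$ row/column sums and $\boldsymbol{r},\boldsymbol{c}$ their vectors. The constant implied by $\Omega$ depends only on the constants $\alpha,\beta,\gamma$. *)

(* Defs.v *)
From mathcomp Require Import all_boot all_order all_algebra.

Set Implicit Arguments.
Unset Strict Implicit.
Unset Printing Implicit Defensive.

Import GRing.Theory Num.Theory.
Local Open Scope ring_scope.

Definition row_sums (R : numFieldType) (n : nat) (A : 'M[R]_n) : 'rV[R]_n :=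
  \row_i \sum_j A i j.

Definition col_sums (R : numFieldType) (n : nat) (A : 'M[R]_n) : 'rV[R]_n :=
  \row_j \sum_i A i j.

Definition row_normalize (R : numFieldType) (n : nat) (A : 'M[R]_n) : 'M[R]_n :=
  \matrix_(i, j) (A i j / row_sums A 0 i).

Definition col_normalize (R : numFieldType) (n : nat) (A : 'M[R]_n) : 'M[R]_n :=
  \matrix_(i, j) (A i j / col_sums A 0 j).

(* The Sinkhorn-Knopp iterates A^(k) for the target marginals (1, 1).
   A^(0) is already row-normalized; it is not A itself. *)
Fixpoint SK (R : numFieldType) (n : nat) (A : 'M[R]_n) (k : nat) : 'M[R]_n :=
  match k with
  | 0 => row_normalize A
  | k'.+1 =>
      if odd k'.+1 then col_normalize (SK A k') else row_normalize (SK A k')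
  end.

Definition norm1 (R : numFieldType) (n : nat) (v : 'rV[R]_n) : R :=
  \sum_i `|v 0 i|.

Definition SK_error (R : numFieldType) (n : nat) (A : 'M[R]_n) : R :=
  norm1 (row_sums A - const_mx 1) + norm1 (col_sums A - const_mx 1).

Definition SK_first (R : numFieldType) (n : nat) (A : 'M[R]_n) (eps : R)
    (K : nat) : Prop :=
  SK_error (SK A K) <= eps /\
  (forall k : nat, SK_error (SK A k) <= eps -> (K <= k)%N).

(* The top-left block is t x s: t counts rows and s counts columns. *)
Definition two_block_mx (R : numFieldType) (n s t : nat)
    (th11 th12 th21 th22 : R) : 'M[R]_n :=
  \matrix_(i, j)
    if (i < t)%N then (if (j < s)%N then th11 else th12)
    else (if (j < s)%N then th21 else th22).

(* Main.v *)
(* Every iterate keeps the 2x2 block shape, so the iteration lives on four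
   entries. The bottom-left entry starts at nu and is divided by marginals
   bounded below by some 1/G, while an error below s - t forces it to be at
   least gamma / (2 n): hence 2 n nu G^K >= gamma. On the other hand, the
   cross ratio of the entries is invariant and bounded away from 1 (this is
   what the bound on th12 gives), so the difference between the two marginals
   shrinks by at most a constant factor q per step: hence eps >= const n q^K.
   The product of the two inequalities is free of n. *)
Require Import Defs.
From mathcomp Require Import all_boot all_order all_algebra.
From mathcomp Require Import reals exp ring lra.
Import Order.TTheory GRing.Theory Num.Theory.
Local Open Scope ring_scope.
Set Implicit Arguments.
Unset Strict Implicit.

(** * One normalization step on the four block entries *)

Section Step.
Variables (R : realFieldType) (kappa eta G N : R).

(* A row-normalized matrix with row blocks of sizes m1, m2, column blocks of
   sizes w1, w2 and block entries a, b / c, d; kappa, eta and G bound the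
   block sizes, the cross ratio b c / (a d) and the column sums. *)
Record admissible (m1 m2 w1 w2 a b c d : R) : Prop := Admissible {
  adm_m : m1 + m2 = N; adm_w : w1 + w2 = N;
  adm_m1 : kappa * N <= m1; adm_m2 : kappa * N <= m2;
  adm_w1 : kappa * N <= w1; adm_w2 : kappa * N <= w2;
  adm_a : 0 < a; adm_b : 0 < b; adm_c : 0 < c; adm_d : 0 < d;
  adm_r1 : w1 * a + w2 * b = 1; adm_r2 : w1 * c + w2 * d = 1;
  adm_lo : G^-1 <= m1 * a + m2 * c; adm_le1 : m1 * a + m2 * c <= 1;
  adm_ge1 : 1 <= m1 * b + m2 * d; adm_hi : m1 * b + m2 * d <= G;
  adm_cross : b * c <= (1 - eta) * (a * d) }.

Hypotheses (kappa_gt0 : 0 < kappa) (eta_gt0 : 0 < eta) (G_gt1 : 1 < G)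
  (N_gt0 : 0 < N).

(** The contrast bound [eta * (kappa / G) ^+ 2] times the [G^-1] lost to the two column sums, whose
    product is at most [G]. *)
Definition decay := eta * kappa ^+ 2 / G ^+ 3.

Lemma decay_gt0 : 0 < decay.
Proof. by rewrite divr_gt0 ?mulr_gt0 ?exprn_gt0 // (lt_trans _ G_gt1). Qed.

Lemma decay_lt1 : kappa < 1 -> eta < 1 -> decay < 1.
Proof.
move=> k1 e1; have G_gt0 : 0 < G by rewrite (lt_trans _ G_gt1).
rewrite ltr_pdivrMr ?exprn_gt0 // mul1r (@lt_trans _ _ 1) ?exprn_egt1 //.
by rewrite mulr_ilt1 ?exprn_ge0 ?exprn_ilt1 // ltW.
Qed.

Section OneState.
Variables (m1 m2 w1 w2 a b c d : R).
Hypothesis adm : admissible m1 m2 w1 w2 a b c d.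
Let c1 := m1 * a + m2 * c.
Let c2 := m1 * b + m2 * d.

(** As both rows sum to 1, the difference is [w1 * w2] times the determinant [a * d - b * c], which
    the cross ratio bound keeps above [eta * (a * d)]. *)
Lemma admissible_contrast : eta * (kappa / G) ^+ 2 <= w1 * a - w1 * c.
Proof.
case: adm => mN wN hm1 hm2 hw1 hw2 ha hb hc hd r1 r2 lo le1 ge1 hi cr.
have kN : 0 < kappa * N by rewrite mulr_gt0.
have G0 : 0 < G by lra.
have w10 : 0 < w1 by lra.
have w20 : 0 < w2 by lra.
have m10 : 0 < m1 by lra.
have m20 : 0 < m2 by lra.
have ad0 : 0 < a * d by rewrite mulr_gt0.
have E : w1 * a - w1 * c = w1 * w2 * (a * d - b * c).
  have -> : w1 * a - w1 * c = w1 * a * (w1 * c + w2 * d)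
      - w1 * c * (w1 * a + w2 * b) by rewrite r1 r2 !mulr1.
  by ring.
have ac : w1 * c <= w1 * a.
  have : 0 < eta * (a * d) by rewrite mulr_gt0.
  by move=> ?; rewrite -subr_ge0 E !mulr_ge0 ?(ltW w10) ?(ltW w20) //; lra.
have bd : w2 * b <= w2 * d by lra.
rewrite !ler_pM2l // in ac bd.
(* A column sum is at most [N] times its larger entry, so the diagonal weights [w1 * a] and [w2 * d]
   are at least [kappa / G]. *)
have kG (w x : R) : kappa * N <= w -> 0 < x -> G^-1 <= N * x ->
    kappa / G <= w * x.
  move=> hw x0 h; apply: (@le_trans _ _ (kappa * (N * x))).
    by rewrite ler_pM2l.
  by rewrite mulrA ler_pM2r.
have h1 : kappa / G <= w1 * a.
  by apply: kG => //; rewrite (le_trans lo) // -mN mulrDl lerD2l ler_pM2l.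
have h2 : kappa / G <= w2 * d.
  apply: kG => //; apply: (@le_trans _ _ 1); first by rewrite invf_le1 // ltW.
  by rewrite (le_trans ge1) // -mN mulrDl lerD2r ler_pM2l.
have kG0 : 0 < kappa / G by rewrite divr_gt0.
rewrite E; apply: (@le_trans _ _ (eta * ((w1 * a) * (w2 * d)))).
  by rewrite ler_pM2l // expr2 ler_pM // ltW.
have -> : eta * (w1 * a * (w2 * d)) = w1 * w2 * (eta * (a * d)) by ring.
by rewrite ler_pM2l ?mulr_gt0 //; lra.
Qed.

(* The row sums after column normalization, in reverse order: the anti-transpose
   turns the next row normalization into another column normalization and
   preserves the ordering of the two marginals. *)
Let c1' := w2 * (d / c2) + w1 * (c / c1).
Let c2' := w2 * (b / c2) + w1 * (a / c1).

(** The new gap is exactly the old one times [(w1 * a - w1 * c) / (c1 * c2)], and [c1 <= 1],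
    [c2 <= G] bound the denominator. *)
Lemma gap_step : decay * (c2 - c1) <= c2' - c1'.
Proof.
have hc := admissible_contrast.
case: adm => mN wN hm1 hm2 hw1 hw2 ha hb hc0 hd r1 r2 lo le1 ge1 hi cr.
have G0 : 0 < G by lra.
have c10 : 0 < c1 by rewrite (lt_le_trans _ lo) // invr_gt0.
have c20 : 0 < c2 by rewrite (lt_le_trans _ ge1).
have -> : c2' - c1' = (w1 * a - w1 * c) * ((c2 - c1) / (c1 * c2)).
  have -> : c2' - c1' = (w2 * b - w2 * d) / c2 + (w1 * a - w1 * c) / c1.
    by rewrite /c2' /c1'; ring.
  have -> : w2 * b - w2 * d = w1 * c - w1 * a by lra.
  by field; rewrite !gt_eqF.
have -> : decay * (c2 - c1) = eta * (kappa / G) ^+ 2 * ((c2 - c1) / G).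
  by rewrite /decay; field; rewrite gt_eqF.
have cG : c1 * c2 <= G.
  by apply: le_trans hi; rewrite -[leRHS]mul1r ler_pM2r.
have gap0 : 0 <= c2 - c1 by rewrite subr_ge0 (le_trans le1).
apply: ler_pM => //.
- by rewrite mulr_ge0 ?sqr_ge0 // ltW.
- by rewrite divr_ge0 // ltW.
- by rewrite ler_wpM2l // lef_pV2 // posrE mulr_gt0.
Qed.

(** The anti-transpose fixes the bottom-left corner, so [c] follows the entry that starts at
    [nu]. *)
Lemma corner_step : c / c1 <= G * c.
Proof.
case: adm => mN wN hm1 hm2 hw1 hw2 ha hb hc0 hd r1 r2 lo le1 ge1 hi cr.
have G0 : 0 < G by lra.
have c10 : 0 < c1 by rewrite (lt_le_trans _ lo) // invr_gt0.
by rewrite mulrC ler_pM2r // -[leRHS]invrK lef_pV2 ?posrE ?invr_gt0.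
Qed.

(** The cross ratio is unchanged. The new column sums lie between [1 / c2] and [1 / c1], and
    straddle 1 because their gap is nonnegative and their weighted mean is 1. *)
Lemma admissible_step :
  admissible w2 w1 m2 m1 (d / c2) (b / c2) (c / c1) (a / c1).
Proof.
have gap := gap_step.
case: adm => mN wN hm1 hm2 hw1 hw2 ha hb hc0 hd r1 r2 lo le1 ge1 hi cr.
have G0 : 0 < G by lra.
have kN : 0 < kappa * N by rewrite mulr_gt0.
have w10 : 0 < w1 by lra.
have w20 : 0 < w2 by lra.
have c10 : 0 < c1 by rewrite (lt_le_trans _ lo) // invr_gt0.
have c20 : 0 < c2 by rewrite (lt_le_trans _ ge1).
have gap0 : c1' <= c2'.
  rewrite -subr_ge0 (le_trans _ gap) // mulr_ge0 ?subr_ge0 ?(le_trans le1) //.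
  exact/ltW/decay_gt0.
have mass : m2 * c1' + m1 * c2' = N.
  have -> : m2 * c1' + m1 * c2' =
      w1 * ((m1 * a + m2 * c) / c1) + w2 * ((m1 * b + m2 * d) / c2).
    by rewrite /c2' /c1'; ring.
  by rewrite !divff ?gt_eqF // !mulr1.
have m10 : 0 < m1 by lra.
have m20 : 0 < m2 by lra.
have lo' : c2^-1 <= c1'.
  have -> : c2^-1 = w2 * (d / c2) + w1 * (c / c2).
    by rewrite -[LHS]mul1r -r2; ring.
  rewrite lerD2l !ler_pM2l // lef_pV2 //.
  by rewrite (le_trans le1).
have hi' : c2' <= c1^-1.
  have -> : c1^-1 = w2 * (b / c1) + w1 * (a / c1).
    by rewrite -[LHS]mul1r -r1; ring.
  rewrite lerD2r !ler_pM2l // lef_pV2 //.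
  by rewrite (le_trans le1).
have cross' : b / c2 * (c / c1) <= (1 - eta) * (d / c2 * (a / c1)).
  have -> : b / c2 * (c / c1) = b * c * (c1 * c2)^-1.
    by field; rewrite !gt_eqF.
  have -> : (1 - eta) * (d / c2 * (a / c1)) =
      (1 - eta) * (a * d) * (c1 * c2)^-1.
    by field; rewrite !gt_eqF.
  by rewrite ler_pM2r // invr_gt0 mulr_gt0.
split => //; rewrite ?divr_gt0 //; try lra.
- by rewrite -(divff (lt0r_neq0 c20)) /c2; ring.
- by rewrite -(divff (lt0r_neq0 c10)) /c1; ring.
- by rewrite (le_trans _ lo') // lef_pV2.
- rewrite -(ler_pM2l N_gt0) mulr1 -[leRHS]mass -mN mulrDl addrC lerD2l.
  by rewrite ler_pM2l.
- rewrite -(ler_pM2l N_gt0) mulr1 -[leLHS]mass -mN mulrDl addrC lerD2l.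
  by rewrite ler_pM2l.
- rewrite (le_trans hi') // -[leRHS]invrK lef_pV2 // posrE invr_gt0 //.
Qed.

(** For a row-normalized state this is the whole error, since every row sum is 1. *)
Definition imbalance := w1 * `|c1 - 1| + w2 * `|c2 - 1|.

Lemma imbalance_ge_gap : kappa * N * (c2 - c1) <= imbalance.
Proof.
case: adm => mN wN hm1 hm2 hw1 hw2 ha hb hc0 hd r1 r2 lo le1 ge1 hi cr.
have -> : kappa * N * (c2 - c1) =
    kappa * N * (1 - c1) + kappa * N * (c2 - 1) by ring.
rewrite /imbalance ler0_norm ?subr_le0 // ger0_norm ?subr_ge0 // opprB.
by rewrite lerD // ler_wpM2r // subr_ge0.
Qed.

(** The shortfall of the first columns equals the surplus of the others. When [w1 > m1], the [m1]
    rows of sum 1 cannot fill the [w1] columns, so a small imbalance needs a sizable [c]. *)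
Lemma imbalance_ge_deficit : 2 * (w1 - m1 - m2 * w1 * c) <= imbalance.
Proof.
case: adm => mN wN hm1 hm2 hw1 hw2 ha hb hc0 hd r1 r2 lo le1 ge1 hi cr.
rewrite /imbalance ler0_norm ?subr_le0 // ger0_norm ?subr_ge0 // opprB.
have kN : 0 < kappa * N by rewrite mulr_gt0.
have hb' : 0 <= w2 * b by rewrite mulr_ge0 ?ltW //; lra.
have hma : m1 * (w1 * a) <= m1 * 1 by rewrite ler_wpM2l; lra.
have mass : w1 * c1 + w2 * c2 = m1 + m2.
  transitivity (m1 * (w1 * a + w2 * b) + m2 * (w1 * c + w2 * d)).
    by rewrite /c1 /c2; ring.
  by rewrite r1 r2 !mulr1.
have wc1 : w1 * c1 = m1 * (w1 * a) + m2 * w1 * c by rewrite /c1; ring.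
lra.
Qed.

End OneState.
End Step.

(** * Normalization and error of two-by-two block matrices *)

Lemma sum_ord_lt (R : pzRingType) (n s : nat) (x y : R) : (s <= n)%N ->
  \sum_(j < n) (if (j < s)%N then x else y) = s%:R * x + (n%:R - s%:R) * y.
Proof.
move=> sn; rewrite -(big_mkord xpredT (fun j => if (j < s)%N then x else y)).
rewrite (big_cat_nat (n := s)) //= -natrB // !mulr_natl -sumr_const_nat.
have -> : x *+ s = \sum_(0 <= j < s) x by rewrite sumr_const_nat subn0.
congr (_ + _); apply: eq_big_nat => j.
  by move=> /andP[_ ->].
by move=> /andP[sj _]; rewrite ltnNge sj.
Qed.

Section Block.
Variables (R : numFieldType) (n s t : nat).
Hypotheses (sn : (s <= n)%N) (tn : (t <= n)%N).
Variables a b c d : R.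
Let A := two_block_mx n s t a b c d.
Let r1 := s%:R * a + (n%:R - s%:R) * b.
Let r2 := s%:R * c + (n%:R - s%:R) * d.
Let c1 := t%:R * a + (n%:R - t%:R) * c.
Let c2 := t%:R * b + (n%:R - t%:R) * d.

Lemma row_sums_two_block i :
  row_sums A 0 i = if (i < t)%N then r1 else r2.
Proof.
rewrite mxE /r1 /r2 -!sum_ord_lt //.
by case: ifP => it; apply: eq_bigr => j _; rewrite mxE it.
Qed.

Lemma col_sums_two_block j :
  col_sums A 0 j = if (j < s)%N then c1 else c2.
Proof.
rewrite mxE /c1 /c2 -!sum_ord_lt //.
by case: ifP => js; apply: eq_bigr => i _; rewrite mxE js.
Qed.

Lemma row_normalize_two_block :
  row_normalize A = two_block_mx n s t (a / r1) (b / r1) (c / r2) (d / r2).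
Proof.
apply/matrixP => i j; rewrite mxE row_sums_two_block !mxE.
by case: ifP; case: ifP.
Qed.

Lemma col_normalize_two_block :
  col_normalize A = two_block_mx n s t (a / c1) (b / c2) (c / c1) (d / c2).
Proof.
apply/matrixP => i j; rewrite mxE col_sums_two_block !mxE.
by case: ifP; case: ifP.
Qed.

Lemma SK_error_two_block :
  SK_error A = t%:R * `|r1 - 1| + (n%:R - t%:R) * `|r2 - 1|
             + (s%:R * `|c1 - 1| + (n%:R - s%:R) * `|c2 - 1|).
Proof.
rewrite /SK_error /norm1 -!sum_ord_lt //.
congr (_ + _); apply: eq_bigr => i _; rewrite mxE.
  by rewrite row_sums_two_block !mxE; case: ifP.
by rewrite col_sums_two_block !mxE; case: ifP.
Qed.

End Block.

(** * Error bounds along the whole iteration *)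

Lemma SK_error_lower (R : realFieldType) (kappa eta G : R) (n s t : nat)
    (a0 b0 c0 d0 : R) (k : nat) :
  0 < kappa -> 0 < eta -> 1 < G -> (0 < n)%N -> (s <= n)%N -> (t <= n)%N ->
  admissible kappa eta G n%:R t%:R (n%:R - t%:R) s%:R (n%:R - s%:R)
    a0 b0 c0 d0 ->
  let E := SK_error (SK (two_block_mx n s t a0 b0 c0 d0) k) in
  let gap := (t%:R * b0 + (n%:R - t%:R) * d0)
           - (t%:R * a0 + (n%:R - t%:R) * c0) in
  kappa * n%:R * (decay kappa eta G ^+ k * gap) <= E /\
  2 * (s%:R - t%:R - n%:R ^+ 2 * (G ^+ k * c0)) <= E.
Proof.
move=> kappa0 eta0 G1 n0 sn tn adm0 E gap.
have N0 : 0 < n%:R :> R by rewrite ltr0n.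
have G0 : 0 < G by apply: lt_trans G1.
have q0 : 0 < decay kappa eta G by apply: decay_gt0.
pose good m1 m2 w1 w2 j a b c d :=
  [/\ admissible kappa eta G n%:R m1 m2 w1 w2 a b c d,
      decay kappa eta G ^+ j * gap <= (m1 * b + m2 * d) - (m1 * a + m2 * c)
    & c <= G ^+ j * c0].
have good_step m1 m2 w1 w2 j a b c d : good m1 m2 w1 w2 j a b c d ->
    good w2 w1 m2 m1 j.+1 (d / (m1 * b + m2 * d)) (b / (m1 * b + m2 * d))
      (c / (m1 * a + m2 * c)) (a / (m1 * a + m2 * c)).
  case=> adm hgap hc; split; first exact: admissible_step adm.
    apply: le_trans (gap_step kappa0 eta0 G1 N0 adm).
    by rewrite exprS -mulrA ler_pM2l.
  apply: (le_trans (corner_step adm)).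
  by rewrite exprS -mulrA ler_pM2l.
(* The excess [w1 - m1] is [s - t] in both storage orders, as [(n - t) - (n - s) = s - t]. *)
have good_err m1 m2 w1 w2 j a b c d : good m1 m2 w1 w2 j a b c d ->
    w1 - m1 = s%:R - t%:R ->
    let e := imbalance m1 m2 w1 w2 a b c d in
    kappa * n%:R * (decay kappa eta G ^+ j * gap) <= e /\
    2 * (s%:R - t%:R - n%:R ^+ 2 * (G ^+ j * c0)) <= e.
  case=> adm hgap hc hst e; split.
    apply: le_trans (imbalance_ge_gap adm).
    by rewrite ler_pM2l // mulr_gt0.
  apply: le_trans (imbalance_ge_deficit kappa0 N0 adm).
  case: adm => mN wN hm1 hm2 hw1 hw2 _ _ hc0 _ _ _ _ _ _ _ _.
  have kN : 0 < kappa * n%:R by rewrite mulr_gt0.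
  rewrite hst ler_pM2l // lerD2l lerN2 ler_pM //; try lra.
    by rewrite mulr_ge0; lra.
  by rewrite expr2 ler_pM //; lra.
(* The odd iterates are stored anti-transposed, so that column and row
   normalization act by the same formula on the four entries. *)
have [a [b [c [d hk]]]] : exists a b c d, if odd k
    then SK (two_block_mx n s t a0 b0 c0 d0) k = two_block_mx n s t d b c a /\
         good (n%:R - s%:R) s%:R (n%:R - t%:R) t%:R k a b c d
    else SK (two_block_mx n s t a0 b0 c0 d0) k = two_block_mx n s t a b c d /\
         good t%:R (n%:R - t%:R) s%:R (n%:R - s%:R) k a b c d.
  elim: k {E} => [|k [a [b [c [d]]]]].
    exists a0, b0, c0, d0; split; last by split; rewrite ?expr0 ?mul1r.
    by rewrite /= row_normalize_two_block // (adm_r1 adm0) (adm_r2 adm0) !divr1.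
  rewrite [SK _ k.+1]/= [odd k.+1]/=.
  case: (odd k) => /= -[-> /good_step h]; do 4!eexists; split; try exact: h.
    rewrite row_normalize_two_block //.
    by congr two_block_mx; congr (_ / _); rewrite addrC.
  by rewrite col_normalize_two_block.
have t0 : 0 <= t%:R :> R by rewrite ler0n.
have s0 : 0 <= s%:R :> R by rewrite ler0n.
have nt0 : 0 <= n%:R - t%:R :> R by rewrite subr_ge0 ler_nat.
have ns0 : 0 <= n%:R - s%:R :> R by rewrite subr_ge0 ler_nat.
(* The imbalance is the column half of the error for even [k] and the row half for odd [k]; the
   other half is nonnegative. *)
have E_ge : exists m1 m2 w1 w2 a b c d, [/\ good m1 m2 w1 w2 k a b c d,
    w1 - m1 = s%:R - t%:R & imbalance m1 m2 w1 w2 a b c d <= E].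
  move: hk; rewrite /E; case: (odd k) => -[-> h];
    do 8!eexists; split; try exact: h.
  - by ring.
  - rewrite SK_error_two_block // /imbalance.
    rewrite [X in _ <= X + _]addrC [t%:R * _ + _]addrC.
    rewrite ![s%:R * _ + (_ - _) * _]addrC lerDl.
    by rewrite addr_ge0 // mulr_ge0.
  - by [].
  - by rewrite SK_error_two_block // /imbalance lerDr addr_ge0 // mulr_ge0.
have [m1 [m2 [w1 [w2 [? [? [? [? [h hst le]]]]]]]]] := E_ge.
have [h1 h2] := good_err _ _ _ _ _ _ _ _ _ h hst.
by split; [apply: le_trans h1 le | apply: le_trans h2 le].
Qed.

(** * Admissibility of the starting matrix *)

(** [G] covers the first column sum, which exceeds [t / n >= alpha], and the second, which exceeds 1
    by less than [(1 - beta)^-1]; [kappa] is below both [alpha] and [1 - beta]. *)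
Lemma two_block_admissible (R : realFieldType) (alpha beta n s t a b c d : R) :
  0 < alpha < 1 -> 0 < beta < 1 -> 0 < n ->
  alpha * n <= t -> t < s -> s <= beta * n ->
  0 < a -> 0 < b -> 0 < c -> 0 < d ->
  b < 6 * n / (6 * n ^+ 2 + 5 * s * (n - t)) ->
  s * a + (n - s) * b = 1 -> s * c + (n - s) * d = 1 ->
  (t - n) / n < t * a + (n - t) * c - 1 < 0 ->
  0 < t * b + (n - t) * d - 1 < s * (n - t) / (n * (n - s)) ->
  admissible (alpha * (1 - beta)) (5 * alpha * (1 - beta) / 11)
    (alpha^-1 + (1 - beta)^-1) n t (n - t) s (n - s) a b c d.
Proof.
move=> /andP[al0 al1] /andP[be0 be1] n0 ht ts hs ha hb hc hd b_lt r1 r2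
  /andP[c1_gt c1_lt] /andP[c2_gt c2_lt].
have an0 : 0 < alpha * n by rewrite mulr_gt0.
have bn0 : 0 < (1 - beta) * n by rewrite mulr_gt0 ?subr_gt0.
have ben0 : 0 < beta * n by rewrite mulr_gt0.
have [t0 s0] : 0 < t /\ 0 < s by split; lra.
have [ns nt] : 0 < n - s /\ 0 < n - t by split; lra.
have kle1 : alpha * (1 - beta) * n <= alpha * n.
  by rewrite ler_pM2r //; rewrite ger_pMr //; lra.
have kle2 : alpha * (1 - beta) * n <= (1 - beta) * n.
  by rewrite ler_pM2r //; rewrite ger_pMl //; lra.
have ib0 : 0 < (1 - beta)^-1 by rewrite invr_gt0 subr_gt0.
have ia1 : 1 <= alpha^-1 by rewrite invf_ge1 // ltW.
split => //; try lra.
- apply: (@le_trans _ _ alpha).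
    by rewrite -[leRHS]invrK lef_pV2 ?posrE ?invr_gt0 //; lra.
  have : alpha <= t / n by rewrite ler_pdivlMr.
  by move: c1_gt; rewrite mulrBl divff ?gt_eqF //; lra.
- have : s * (n - t) / (n * (n - s)) <= (1 - beta)^-1; last by lra.
  have be0' : 0 < 1 - beta by rewrite subr_gt0.
  rewrite ler_pdivrMr ?mulr_gt0 // -(ler_pM2l be0') mulrA [leRHS]mulrA.
  rewrite divff ?gt_eqF // mul1r -mulrA.
  apply: (@le_trans _ _ ((1 - beta) * (n * n))).
    by rewrite ler_pM2l // ler_pM ?(ltW s0) //; lra.
  by rewrite mulrA mulrC ler_pM2l //; lra.
- have Q0 : 0 < 6 * n ^+ 2 + 5 * s * (n - t).
    by rewrite addr_gt0 ?mulr_gt0 ?exprn_gt0 //; lra.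
  rewrite ltr_pdivlMr // in b_lt.
  (* The second column sum exceeds 1, so [(n - t) * (d - b) > 1 - n * b]; the bound on [b] makes the
     right side exceed [5 * s * (n - t)] over the denominator. *)
  have d_b : 5 * s < (d - b) * (6 * n ^+ 2 + 5 * s * (n - t)).
    rewrite -(ltr_pM2l nt).
    have h : 1 - n * b < (n - t) * (d - b) by lra.
    rewrite -(ltr_pM2r Q0) in h.
    have : n * (b * (6 * n ^+ 2 + 5 * s * (n - t))) < n * (6 * n).
      by rewrite ltr_pM2l.
    by move: h; lra.
  have db0 : 0 < d - b.
    by rewrite -(ltr_pM2r Q0) mul0r (lt_trans _ d_b) // mulr_gt0.
  (* The 11 in [eta] is 6 + 5, from [s * (n - t) <= n ^+ 2]. *)
  have Q11 : 6 * n ^+ 2 + 5 * s * (n - t) <= 11 * n ^+ 2.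
    by rewrite expr2; nra.
  have d_b' : 5 * alpha <= 11 * n * (d - b).
    rewrite -(ler_pM2r n0).
    have : (d - b) * (6 * n ^+ 2 + 5 * s * (n - t)) <= (d - b) * (11 * n ^+ 2).
      by rewrite ler_pM2l.
    have -> : 11 * n * (d - b) * n = (d - b) * (11 * n ^+ 2) by ring.
    lra.
  have e_db : 5 * alpha * (1 - beta) / 11 <= (n - s) * (d - b).
    apply: (@le_trans _ _ ((1 - beta) * n * (d - b))); last first.
      by rewrite ler_pM2r //; lra.
    have be0' : 0 < 1 - beta by rewrite subr_gt0.
    by move: d_b'; rewrite -(ler_pM2l be0'); lra.
  have E : (n - s) * (d - b) = s * (n - s) * (a * d - b * c).
    transitivity ((n - s) * (d * (s * a + (n - s) * b)
                             - b * (s * c + (n - s) * d))).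
      by rewrite r1 r2 !mulr1.
    by ring.
  have [sa nb sc nd] : [/\ 0 < s * a, 0 < (n - s) * b, 0 < s * c
    & 0 < (n - s) * d] by split; rewrite mulr_gt0.
  (* This turns the absolute bound on [a * d - b * c] into one relative to [a * d]. *)
  have ad_le : s * (n - s) * (a * d) <= 1.
    have -> : s * (n - s) * (a * d) = s * a * ((n - s) * d) by ring.
    by rewrite mulr_ile1 //; lra.
  have eta0 : 0 < 5 * alpha * (1 - beta) / 11.
    by rewrite divr_gt0 // !mulr_gt0 // subr_gt0.
  have W0 : 0 < s * (n - s) by rewrite mulr_gt0.
  rewrite -(ler_pM2l W0); rewrite -(ler_pM2l eta0) in ad_le.
  by move: ad_le e_db; rewrite E; lra.
Qed.

(** * Passage to logarithms and choice of the constants *)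

(** With [L = - ln nu - ln eps], logarithms give [- k * ln rho >= L + ln b], and the threshold on
    [L] makes this at least [L / 2]; hence the 2 in the constant. *)
Lemma ln_bound_lower (R : realType) (b rho nu eps : R) (k : nat) :
  0 < b -> 0 < rho < 1 -> 0 < nu -> 0 < eps -> b * rho ^+ k <= nu * eps ->
  - 2 * ln b <= - ln nu - ln eps ->
  (- 2 * ln rho)^-1 * (- ln nu - ln eps) <= k%:R.
Proof.
move=> b0 /andP[rho0 rho1] nu0 eps0 h hL.
have rk0 : 0 < rho ^+ k by rewrite exprn_gt0.
have lr : ln rho < 0 by rewrite ln_lt0 // rho0.
have : ln (b * rho ^+ k) <= ln (nu * eps).
  by rewrite ler_ln ?posrE ?mulr_gt0.
rewrite !lnM ?posrE // lnXn // -[ln rho *+ k]mulr_natl => h'.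
rewrite mulrC ler_pdivrMr; last by lra.
by lra.
Qed.

Unset Implicit Arguments.

Theorem theorem6p1 (R : realType) (alpha beta gamma : R)
    (halpha : 0 < alpha < 1) (hbeta : 0 < beta < 1) (hgamma : 0 < gamma < 1) :
  (* the two constants of Omega, chosen from alpha, beta, gamma alone *)
  exists C L0 : R, 0 < C /\
    forall (n s t : nat) (eps nu th11 th12 th21 th22 : R) (K : nat),
      (0 < n)%N -> (0 < s)%N -> (0 < t)%N ->
      alpha * n%:R <= t%:R -> (t < s)%N -> s%:R <= beta * n%:R ->
      gamma * n%:R <= s%:R - t%:R ->
      0 < eps < s%:R - t%:R ->
      0 < nu ->
      0 < th11 -> 0 < th12 -> 0 < th21 -> 0 < th22 ->
      th21 = nu ->
      th12 < 6 * n%:R / (6 * n%:R ^+ 2 + 5 * s%:R * (n%:R - t%:R)) ->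
      s%:R * th11 + (n%:R - s%:R) * th12 = 1 ->
      s%:R * th21 + (n%:R - s%:R) * th22 = 1 ->
      (t%:R - n%:R) / n%:R < t%:R * th11 + (n%:R - t%:R) * th21 - 1 < 0 ->
      s%:R * t%:R * (s%:R - t%:R) / (4 * n%:R ^+ 3)
        < t%:R * th12 + (n%:R - t%:R) * th22 - 1
        < s%:R * (n%:R - t%:R) / (n%:R * (n%:R - s%:R)) ->
      SK_first (two_block_mx n s t th11 th12 th21 th22) eps K ->
      L0 <= - ln nu - ln eps ->
      C * (- ln nu - ln eps) <= K%:R.
Proof.
pose kappa := alpha * (1 - beta).
pose eta := 5 * alpha * (1 - beta) / 11.
pose G := alpha^-1 + (1 - beta)^-1.
(* Lower bound for the initial gap: [s] and [t] are at least [alpha * n], [s - t] is at least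
   [gamma * n], and the first column sum is below 1. *)
pose gap0 := alpha ^+ 2 * gamma / 4.
pose q := decay kappa eta G.
(* The factor left once the product of the two final inequalities is divided by [2 * n * G ^+ K]. *)
pose B := kappa * gap0 * gamma / 2.
have /andP[al0 al1] := halpha.
have /andP[be0 be1] := hbeta.
have /andP[ga0 ga1] := hgamma.
have kappa0 : 0 < kappa by rewrite mulr_gt0 ?subr_gt0.
have kappa1 : kappa < 1 by rewrite /kappa; nra.
have eta0 : 0 < eta by rewrite divr_gt0 // !mulr_gt0 ?subr_gt0.
have eta1 : eta < 1.
  have -> : eta = 5 * kappa / 11 by rewrite /kappa mulrA.
  by move: (kappa) kappa0 kappa1 => k; lra.
have G1 : 1 < G.
  have : 0 < (1 - beta)^-1 by rewrite invr_gt0 subr_gt0.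
  have : 1 <= alpha^-1 by rewrite invf_ge1 // ltW.
  by rewrite /G; lra.
have G0 : 0 < G by apply: lt_trans G1.
have gap00 : 0 < gap0 by rewrite divr_gt0 // mulr_gt0 // exprn_gt0.
have B0 : 0 < B by rewrite divr_gt0 // mulr_gt0 // mulr_gt0.
have q0 : 0 < q by apply: decay_gt0.
have q1 : q < 1 by apply: decay_lt1.
have rho : 0 < q / G < 1.
  by rewrite divr_gt0 //= ltr_pdivrMr // mul1r (lt_trans q1).
exists (- 2 * ln (q / G))^-1, (- 2 * ln B); split.
  by rewrite invr_gt0; have := ln_lt0 rho; lra.
move=> n s t eps nu a b c d K n0 s0 t0 ht ts hs hst /andP[eps0 eps_lt] nu0
  ha hb hc hd cnu b_lt r1 r2 hc1 /andP[c2_gt c2_lt] [hK _] hL.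
have N0 : 0 < n%:R :> R by rewrite ltr0n.
have T0 : 0 < t%:R :> R by rewrite ltr0n.
have S0 : 0 < s%:R :> R by rewrite ltr0n.
have TS : t%:R < s%:R :> R by rewrite ltr_nat.
have SN : s%:R < n%:R :> R by rewrite (le_lt_trans hs) // gtr_pMl.
have gap_lb : gap0 <= s%:R * t%:R * (s%:R - t%:R) / (4 * n%:R ^+ 3).
  have -> : gap0 = alpha * n%:R * (alpha * n%:R) * (gamma * n%:R)
                   / (4 * n%:R ^+ 3).
    by rewrite /gap0; field; rewrite gt_eqF.
  rewrite ler_pM2r ?invr_gt0 ?mulr_gt0 ?exprn_gt0 //.
  by rewrite !ler_pM ?mulr_ge0 ?(ltW al0) ?(ltW ga0) ?(ltW N0) //; lra.
have adm : admissible kappa eta G n%:R t%:R (n%:R - t%:R) s%:R (n%:R - s%:R)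
    a b c d.
  apply: (two_block_admissible halpha hbeta) => //.
  by rewrite c2_lt andbT (lt_trans gap00) // (le_lt_trans gap_lb).
have sn : (s <= n)%N by rewrite -(ler_nat R) ltW.
have [E1 E2] := SK_error_lower K kappa0 eta0 G1 n0 sn
  (leq_trans (ltnW ts) sn) adm.
have qK : 0 < q ^+ K by rewrite exprn_gt0.
have GK : 0 < G ^+ K by rewrite exprn_gt0.
apply: (ln_bound_lower B0 rho) => //.
have {E1} eps_ge : kappa * n%:R * (q ^+ K * gap0) <= eps.
  apply: le_trans hK; apply: le_trans E1.
  rewrite ler_wpM2l ?(ltW (mulr_gt0 _ _)) // ler_wpM2l ?(ltW qK) //.
  by case/andP: hc1; lra.
(* The error is at most [eps < s - t], so [n ^+ 2 * (G ^+ K * nu)] exceeds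
   [(s - t) / 2 >= gamma * n / 2]. *)
have {E2} nu_ge : gamma <= 2 * n%:R * (G ^+ K * nu).
  rewrite -(ler_pM2r N0).
  have -> : 2 * n%:R * (G ^+ K * nu) * n%:R = 2 * (n%:R ^+ 2 * (G ^+ K * nu)).
    by ring.
  by move: (le_trans E2 hK); rewrite cnu; lra.
have lb0 : 0 <= kappa * n%:R * (q ^+ K * gap0).
  by rewrite mulr_ge0 ?ltW // mulr_gt0.
have h := ler_pM lb0 (ltW ga0) eps_ge nu_ge.
have hn : 0 < 2 * n%:R * G ^+ K by rewrite mulr_gt0 // mulr_gt0.
rewrite -(ler_pM2l hn).
have -> : 2 * n%:R * G ^+ K * (B * (q / G) ^+ K) =
    kappa * n%:R * (q ^+ K * gap0) * gamma.
  by rewrite /B expr_div_n; field; rewrite gt_eqF.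
have -> : 2 * n%:R * G ^+ K * (nu * eps) = eps * (2 * n%:R * (G ^+ K * nu)).
  by ring.
exact: h.
Qed.
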